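(* Let $G$ be a directed graph with $P$ vertices and let $C$ be a communication graph for universal broadcast on $G$ with time $\tau=\tau(C)$. Suppose that at most $Q$ directed edges of $G$ can be used simultaneously, i.e. for every time $t$ at most $Q$ edges occurring in the task graphs of $C$ carry the label $t$. Then $\tau\ge \frac{P(P-1)}{Q}$.
   Context: A task graph on $G$ is a finite sequence $(e_i)$ of directed edges of $G$ labeled by positive integer times $t(e_i)$ such that (i) $t(e_i)<t(e_j)$ implies $e_i<e_j$ or $e_i,e_j$ incomparable, and (ii) $t(e_i)=t(e_j)$ implies $i=j$ or $e_i,e_j$ incomparable, where $e_i<e_j$ means there is a directed path in the task graph beginning with $e_i$ and ending with $e_j$. Its time is the maximum label. A communication graph is a collection of task graphs such that no directed edge of $G$ carries a given label more than once in the whole collection; its time $\tau(C)$ is the maximum of the times of its task graphs. A broadcast from a vertex $v$ is a task graph containing a directed path from $v$ to every other vertex. A communication graph for universal broadcast consists of a broadcast from each vertex of $G$. *)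

(* Defs.v *)
From HB Require Import structures.
From mathcomp Require Import all_boot all_order all_algebra.

Set Implicit Arguments.
Unset Strict Implicit.
Unset Printing Implicit Defensive.

Section Precedence.
Variables (V : finType) (n : nat) (e : 'I_n -> V * V).

(* Relations on the indices of a sequence of edges, not on the edges
   themselves: an edge may occur several times in the sequence. *)
Definition follows : rel 'I_n := fun i j => (e i).2 == (e j).1.

(* [connect] also relates each index to itself (the one-edge path). *)
Definition precedes : rel 'I_n := connect follows.

Definition incomparable (i j : 'I_n) : bool :=
  ~~ precedes i j && ~~ precedes j i.

End Precedence.

Record task_graph (V : finType) (G : rel V) := TaskGraph {
  tg_size : nat;
  tg_edge : 'I_tg_size -> V * V;
  tg_label : 'I_tg_size -> nat;
  tg_edgeP : forall i, G (tg_edge i).1 (tg_edge i).2;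
  tg_label_gt0 : forall i, 0 < tg_label i;
  tg_label_lt : forall i j, tg_label i < tg_label j ->
    precedes tg_edge i j \/ incomparable tg_edge i j;
  tg_label_eq : forall i j, tg_label i = tg_label j ->
    i = j \/ incomparable tg_edge i j
}.

Section TaskGraph.
Variables (V : finType) (G : rel V) (T : task_graph G).

Definition tg_time : nat := \max_(i < tg_size T) tg_label i.

Definition tg_adj : rel V := fun x y => [exists i, tg_edge (t := T) i == (x, y)].

Definition is_broadcast (v : V) : Prop :=
  forall w : V, w != v -> connect tg_adj v w.

End TaskGraph.

(* A family of task graphs; the injectivity says that a pair (edge, label)
   determines both the task graph and the index where it occurs. *)
Record communication_graph (V : finType) (G : rel V) (I : finType) :=
  CommunicationGraph {
    cg_task :> I -> task_graph G;
    cg_label_inj : injective (fun o : {k : I & 'I_(tg_size (cg_task k))} =>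
      (tg_edge (tagged o), tg_label (tagged o)))
  }.

Section CommunicationGraph.
Variables (V : finType) (G : rel V).

Definition cg_time (I : finType) (C : communication_graph G I) : nat :=
  \max_(k : I) tg_time (C k).

Definition edges_at (I : finType) (C : communication_graph G I) (t : nat) :
    {set V * V} :=
  [set e | [exists k : I, [exists i : 'I_(tg_size (C k)),
              (tg_edge i == e) && (tg_label i == t)]]].

Definition is_universal_broadcast (C : communication_graph G V) : Prop :=
  forall v : V, is_broadcast (C v) v.

End CommunicationGraph.

(* Main.v *)
(* A broadcast from v has an edge entering each of the P - 1 other vertices, so
   the P broadcasts contain at least P (P - 1) edge occurrences. Each carries a
   label in 1, ..., tau, and a label is carried by at most Q occurrences, since
   an occurrence is determined by its edge and its label. *)

Require Import Defs.
From mathcomp Require Import all_boot all_order all_algebra.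
Import Order.TTheory GRing.Theory Num.Theory.
Local Open Scope ring_scope.

Lemma connect_last_edge (V : finType) (r : rel V) (v w : V) :
  connect r v w -> w != v -> exists u, r u w.
Proof.
case/connectP=> p; case/lastP: p => [|p x]; first by move=> _ ->; rewrite eqxx.
by rewrite rcons_path last_rcons => /andP[_ rx] -> _; exists (last v p).
Qed.

(** The map from an index to the head of its edge reaches every vertex other than [v], since a path
    from [v] to [w] ends with an edge into [w]. *)
Lemma broadcast_size (V : finType) (G : rel V) (T : task_graph G) (v : V) :
  is_broadcast T v -> (#|V|.-1 <= tg_size T)%N.
Proof.
move=> bT; rewrite -[tg_size T]card_ord -(cardsC1 v).
apply: leq_trans (leq_imset_card (fun i => (tg_edge (t := T) i).2) 'I__).
apply/subset_leq_card/subsetP => w; rewrite in_setC1 => wv.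
have [u /existsP[i /eqP ei]] := connect_last_edge V _ v w (bT w wv) wv.
by apply/imsetP; exists i; rewrite // ei.
Qed.

Section Occurrences.
Variables (V : finType) (G : rel V) (I : finType) (C : communication_graph G I).

Let occurrence := {k : I & 'I_(tg_size (C k))}.
Let label (o : occurrence) : nat := tg_label (tagged o).

Lemma label_le_time (o : occurrence) : (label o <= cg_time C)%N.
Proof.
case: o => k i; rewrite /label /cg_time.
apply: leq_trans (leq_bigmax k).
exact: (leq_bigmax (F := fun j => tg_label (t := C k) j) i).
Qed.

Lemma occurrences_at_le (t : nat) :
  (#|[set o : occurrence | label o == t]| <= #|edges_at C t|)%N.
Proof.
pose edge (o : occurrence) := tg_edge (tagged o).
(* By [cg_label_inj], [edge] is injective on occurrences with a common label. *)
rewrite -(card_in_imset (f := edge)); last first.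
  move=> o o'; rewrite !inE => /eqP lo /eqP lo' eo.
  by apply: (@cg_label_inj _ _ _ C); congr (_, _); rewrite // -/(label _) lo -lo'.
apply/subset_leq_card/subsetP => e /imsetP[[k i]]; rewrite inE => li ->.
by rewrite inE; apply/existsP; exists k; apply/existsP; exists i; rewrite eqxx.
Qed.

Lemma occurrences_le (Q : nat) (hQ : forall t, (#|edges_at C t| <= Q)%N) :
  (#|{: occurrence}| <= cg_time C * Q)%N.
Proof.
pose lab (o : occurrence) : 'I_(cg_time C).+1 := inord (label o).
have labE o : lab o = label o :> nat by rewrite inordK // ltnS label_le_time.
rewrite -sum1_card (partition_big lab xpredT) //= big_ord_recl /=.
(* Labels are positive, so the class of label 0 is empty and only [cg_time C] classes remain. *)
rewrite big_pred0 => [|o]; last first.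
  by rewrite -val_eqE /= labE eqn0Ngt tg_label_gt0.
rewrite add0n -[X in (_ <= X * _)%N]card_ord -sum_nat_const.
(* With class 0 split off, index [t] stands for the label [t.+1]. *)
apply: leq_sum => t _; apply: leq_trans (hQ t.+1).
apply: leq_trans (occurrences_at_le t.+1).
rewrite sum1_card; apply/subset_leq_card/subsetP => o.
by rewrite !inE => /eqP lo; rewrite -labE lo.
Qed.

End Occurrences.

Theorem theorem3p1 (V : finType) (G : rel V) (P Q : nat)
    (C : communication_graph G V)
    (hP : #|V| = P)
    (hC : is_universal_broadcast C)
    (hQ0 : (0 < Q)%N)
    (hQ : forall t : nat, (#|edges_at C t| <= Q)%N) :
  P%:R * (P%:R - 1) / Q%:R <= (cg_time C)%:R :> rat.
Proof.
have count : (P * P.-1 <= cg_time C * Q)%N.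
  apply: leq_trans (occurrences_le V G V C Q hQ).
  rewrite card_tagged sumnE big_map big_enum /= -hP -sum_nat_const.
  by apply: leq_sum => v _; rewrite card_ord; apply: broadcast_size (hC v).
rewrite ler_pdivrMr ?ltr0n // -natrM.
(* The truncated [P.-1] agrees with [P%:R - 1] only for positive [P]; for [P = 0] the left side
   vanishes. *)
case: P {hP} count => [|p] count; first by rewrite mul0r ler0n.
by rewrite -{2}natr1 addrK -natrM ler_nat.
Qed.
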